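(* For every $n\in\mathbb{N}$, $n\ge 1$, $(A,\mathcal{R})$ is a complete rewriting system, and its irreducible words are exactly the lexicographically minimal words representing elements of the sylvester monoid $S_n$ (that is, the words $w\in A^*$ that are lexicographically minimal among all words in $A^*$ representing the same element of $S_n$ as $w$).
   Context: Let $A=\{1<2<\dots<n\}$ and let $\mathcal{R}=\{(cavb,acvb):a,b,c\in A,\ a\le b<c,\ v\in A^*\}$ (an infinite set in general). The sylvester monoid of rank $n$, denoted $S_n$, is the monoid presented by $\langle A\mid\mathcal{R}\rangle$. Regarded as a rewriting system, $(A,\mathcal{R})$ has the rules $cavb\to acvb$. Rewriting systems (the set of rules may be infinite): $u\to v$ in one step if $u=x\ell y$, $v=xry$ for a rule $\ell\to r$ and words $x,y$; $\to^*$ is the reflexive transitive closure. A word is irreducible if it contains no left-hand side of a rule as a (contiguous) subword. The system is noetherian if there is no infinite sequence $u_1\to u_2\to\cdots$; confluent if $u\to^*u'$ and $u\to^*u''$ imply there is $v$ with $u'\to^*v$ and $u''\to^*v$; complete if it is noetherian and confluent. The lexicographic order is the one on $A^*$ induced by the order $1<2<\dots<n$ on $A$. *)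

(* Defs.v *)
From HB Require Import structures.
From Stdlib Require Import Relation_Definitions Relation_Operators.
From mathcomp Require Import all_boot all_order.
From mathcomp Require Import boolp.

Set Implicit Arguments.
Unset Strict Implicit.
Unset Printing Implicit Defensive.

Import Order.TTheory.

(* A rewriting system over A is given by its (possibly infinite) set of rules,
   R l r meaning that (l, r) is a rule. *)

Definition one_step (A : Type) (R : relation (seq A)) : relation (seq A) :=
  fun u v => exists x y l r, [/\ R l r, u = x ++ l ++ y & v = x ++ r ++ y].

Definition rewrites (A : Type) (R : relation (seq A)) : relation (seq A) :=
  clos_refl_trans (seq A) (one_step R).

Definition irreducible_word (A : eqType) (R : relation (seq A)) (w : seq A) :
    Prop :=
  forall l r, R l r -> ~~ infix l w.

Definition noetherian (A : Type) (R : relation (seq A)) : Prop :=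
  ~ exists u : nat -> seq A, forall i, one_step R (u i) (u i.+1).

Definition confluent (A : Type) (R : relation (seq A)) : Prop :=
  forall u u' u'', rewrites R u u' -> rewrites R u u'' ->
  exists2 v, rewrites R u' v & rewrites R u'' v.

Definition complete_system (A : Type) (R : relation (seq A)) : Prop :=
  noetherian R /\ confluent R.

(* The least congruence of the free monoid seq A containing R. *)
Inductive congruence_gen (A : Type) (R : relation (seq A)) : relation (seq A) :=
| CongrRule u v : R u v -> congruence_gen R u v
| CongrRefl u : congruence_gen R u u
| CongrSym u v : congruence_gen R u v -> congruence_gen R v u
| CongrTrans u v w :
    congruence_gen R u v -> congruence_gen R v w -> congruence_gen R u w
| CongrMul u u' v v' :
    congruence_gen R u u' -> congruence_gen R v v' ->
    congruence_gen R (u ++ v) (u' ++ v').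

Section PresentedMonoid.
Variables (A : choiceType) (R : relation (seq A)).

Definition congruence_rel : rel (seq A) := fun u v => `[< congruence_gen R u v >].

Lemma congruence_rel_refl : reflexive congruence_rel.
Proof. by move=> u; apply/asboolP; exact: CongrRefl. Qed.

Lemma congruence_rel_sym : symmetric congruence_rel.
Proof. by move=> u v; apply/asboolP/asboolP; exact: CongrSym. Qed.

Lemma congruence_rel_trans : transitive congruence_rel.
Proof.
by move=> v u w /asboolP uv /asboolP vw; apply/asboolP; exact: CongrTrans vw.
Qed.

Canonical congruence_equiv :=
  EquivRel congruence_rel
    congruence_rel_refl congruence_rel_sym congruence_rel_trans.

(* The monoid presented by <A | R>, i.e. the quotient of seq A by the congruence
   generated by R. *)
Definition presented : Type := {eq_quot congruence_equiv}%qT.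

HB.instance Definition _ := Choice.on presented.

(* The element represented by the word w. *)
Definition elt_of (w : seq A) : presented := (\pi_{eq_quot congruence_equiv} w)%qT.

Lemma elt_ofP (u v : seq A) : elt_of u = elt_of v <-> congruence_gen R u v.
Proof.
split; first by move/eqmodP/asboolP.
by move=> uv; apply/eqmodP/asboolP.
Qed.

Definition presented_mul (x y : presented) : presented :=
  elt_of (repr (x : {eq_quot congruence_equiv}%qT)
          ++ repr (y : {eq_quot congruence_equiv}%qT)).

Lemma elt_of_repr (x : presented) :
  elt_of (repr (x : {eq_quot congruence_equiv}%qT)) = x.
Proof. exact: reprK. Qed.

Lemma presented_mulE (u v : seq A) :
  presented_mul (elt_of u) (elt_of v) = elt_of (u ++ v).
Proof.
by apply/elt_ofP/CongrMul; apply/elt_ofP; exact: elt_of_repr.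
Qed.

Lemma presented_mulA : associative presented_mul.
Proof.
move=> x y z; rewrite -(elt_of_repr x) -(elt_of_repr y) -(elt_of_repr z).
by rewrite !presented_mulE catA.
Qed.

Lemma presented_mul1x : left_id (elt_of [::]) presented_mul.
Proof. by move=> x; rewrite -(elt_of_repr x) presented_mulE. Qed.

Lemma presented_mulx1 : right_id (elt_of [::]) presented_mul.
Proof. by move=> x; rewrite -(elt_of_repr x) presented_mulE cats0. Qed.

HB.instance Definition _ :=
  isMonoid.Build presented presented_mulA presented_mul1x presented_mulx1.

End PresentedMonoid.

(* The ordered alphabet {1 < ... < n} is 'I_n = {0 < ... < n-1}; letters are
   only ever compared, so the shift is immaterial. *)
Definition word (n : nat) : Type := seq 'I_n.

Inductive sylvester_rule (n : nat) : relation (word n) :=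
| SylvesterRule (a b c : 'I_n) (v : word n) :
    (a <= b)%O -> (b < c)%O ->
    sylvester_rule ([:: c; a] ++ v ++ [:: b]) ([:: a; c] ++ v ++ [:: b]).

Arguments sylvester_rule : clear implicits.

Definition sylvester_monoid (n : nat) : monoidType :=
  presented (sylvester_rule n).

Definition sylvester_elt (n : nat) (w : word n) : sylvester_monoid n :=
  elt_of (sylvester_rule n) w.

(* w is least, for the lexicographic order (in which a proper prefix of a word
   precedes it), among the words representing the same element as w. *)
Definition lex_minimal_representative (n : nat) (w : word n) : Prop :=
  forall u : word n, sylvester_elt u = sylvester_elt w ->
  ((w : seqlexi 'I_n) <= (u : seqlexi 'I_n))%O.

(* Main.v *)
Require Import Defs.
From mathcomp Require Import all_boot all_order.
From Stdlib Require Import Relation_Definitions Relation_Operators.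
From Stdlib Require Import Operators_Properties Wf_nat.

(** A rule $cavb \to acvb$ exchanges two adjacent letters $c > a$, and is
    licensed by a witness $b$ with $a \le b < c$ somewhere to the right.  So
    rewriting a word means sorting adjacent descents, each step being allowed
    or not according to the set of letters on its right ([exchange],
    [one_stepP]).

    Every step removes exactly one inversion, which gives termination
    ([exchange_inversions]).  By Newman's lemma ([newman]) it remains to check
    local confluence ([exchange_locally_confluent]).  Two exchanges at disjoint
    places commute, because an exchange does not change the set of letters to
    the right of the places before it.  Two overlapping exchanges act on a
    factor $dca$ with $d > c > a$, with a witness for $(d, c)$ and one for
    $(c, a)$ in what follows the factor; these two also license all the
    exchanges needed to sort the factor into $acd$, whichever descent is
    treated first.

    Every step moves a smaller letter to the front, hence makes the word
    lexicographically smaller ([exchange_lexi]).  A reducible word is therefore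
    not minimal in its class.  Conversely, by the Church-Rosser property
    ([church_rosser]) every word equivalent to an irreducible word $w$ rewrites
    to $w$, hence is not smaller than $w$. *)

Set Implicit Arguments.
Unset Strict Implicit.
Unset Printing Implicit Defensive.

Import Order.TTheory.

(** * Confluence and termination of rewriting systems on words *)

Section Rewriting.
Variables (A : Type) (R : relation (seq A)).
Implicit Types u v w x y : seq A.

Definition joinable u v := exists2 w, rewrites R u w & rewrites R v w.

Definition locally_confluent :=
  forall u v w, one_step R u v -> one_step R u w -> joinable v w.

Lemma rewrites_step u v : one_step R u v -> rewrites R u v.
Proof. exact: rt_step. Qed.

Lemma rewrites_refl u : rewrites R u u.
Proof. exact: rt_refl. Qed.

Lemma rewrites_trans v u w : rewrites R u v -> rewrites R v w -> rewrites R u w.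
Proof. exact: rt_trans. Qed.

Lemma rewrites_inv u v :
  rewrites R u v -> u = v \/ exists2 w, one_step R u w & rewrites R w v.
Proof.
move=> uv; have {uv} := clos_rt_rt1n _ _ _ _ uv.
case=> [|w z uw wz]; first by left.
by right; exists w => //; exact: clos_rt1n_rt.
Qed.

Lemma one_step_context x y u v :
  one_step R u v -> one_step R (x ++ u ++ y) (x ++ v ++ y).
Proof.
move=> [x' [y' [l [r [Rlr -> ->]]]]].
by exists (x ++ x'), (y' ++ y), l, r; split; rewrite // -!catA.
Qed.

Lemma rewrites_context x y u v :
  rewrites R u v -> rewrites R (x ++ u ++ y) (x ++ v ++ y).
Proof.
elim=> {u v} [u v uv|u|u v w _ uv _ vw].
- exact/rewrites_step/one_step_context.
- exact: rewrites_refl.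
- exact: rewrites_trans uv vw.
Qed.

Lemma rewrites_cat u u' v v' :
  rewrites R u u' -> rewrites R v v' -> rewrites R (u ++ v) (u' ++ v').
Proof.
move=> uu' vv'; apply: (@rewrites_trans (u' ++ v)).
  exact: (@rewrites_context [::] v).
by have := @rewrites_context u' [::] v v' vv'; rewrite !cats0.
Qed.

Lemma rewrites_congruence u v : rewrites R u v -> congruence_gen R u v.
Proof.
elim=> {u v} [u v [x [y [l [r [Rlr -> ->]]]]]|u|u v w _ uv _ vw].
- apply: CongrMul; first exact: CongrRefl.
  by apply: CongrMul; [exact: CongrRule | exact: CongrRefl].
- exact: CongrRefl.
- exact: CongrTrans uv vw.
Qed.

Lemma joinable_cons a u v :
  joinable u v -> joinable (a :: u) (a :: v).
Proof.
move=> [w uw vw]; exists (a :: w).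
- exact: (rewrites_cat (rewrites_refl [:: a]) uw).
- exact: (rewrites_cat (rewrites_refl [:: a]) vw).
Qed.

Lemma joinable_sym u v : joinable u v -> joinable v u.
Proof. by move=> [w uw vw]; exists w. Qed.

(** By well-founded induction, no word occurs in an infinite sequence of
    steps. *)
Lemma well_founded_noetherian :
  well_founded (fun v u => one_step R u v) -> noetherian R.
Proof.
move=> wfR [u u_step].
suff noseq x : forall i, x <> u i by exact: (noseq (u 0) 0).
elim/(well_founded_ind wfR): x => x IH i xE.
by apply: (IH (u i.+1)) (erefl (u i.+1)); rewrite xE; exact: u_step.
Qed.

(** Join the two first steps locally; the induction hypothesis at each of the
    two resulting words then closes one side of the diagram. *)
Lemma newman :
  well_founded (fun v u => one_step R u v) -> locally_confluent -> confluent R.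
Proof.
move=> wfR lcR; elim/(well_founded_ind wfR) => u IH u' u''.
case/rewrites_inv => [<- uu''|[v uv vu']].
  by exists u''; [|exact: rewrites_refl].
case/rewrites_inv => [<-|[w uw wu'']].
  exists u'; first exact: rewrites_refl.
  exact: rewrites_trans (rewrites_step uv) vu'.
have [t vt wt] := lcR _ _ _ uv uw.
have [p u'p tp] := IH v uv _ _ vu' vt.
have [q pq u''q] := IH w uw _ _ (rewrites_trans wt tp) wu''.
by exists q => //; exact: rewrites_trans u'p pq.
Qed.

(** Confluence is what makes joinability transitive: the two reducts of the
    middle word have a common reduct. *)
Lemma church_rosser u v :
  confluent R -> congruence_gen R u v -> joinable u v.
Proof.
move=> cR; elim=> {u v}.
- move=> u v Ruv; exists v; last exact: rewrites_refl.
  by apply: rewrites_step; exists [::], [::], u, v; rewrite /= !cats0.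
- by move=> u; exists u; exact: rewrites_refl.
- by move=> u v _; exact: joinable_sym.
- move=> u v w _ [p up vp] _ [q vq wq].
  have [t pt qt] := cR _ _ _ vp vq.
  by exists t; [exact: rewrites_trans pt | exact: rewrites_trans qt].
- move=> u u' v v' _ [p up u'p] _ [q vq v'q].
  by exists (p ++ q); exact: rewrites_cat.
Qed.

End Rewriting.

Lemma irreducible_wordP (A : eqType) (R : relation (seq A)) (w : seq A) :
  irreducible_word R w <-> forall u, ~ one_step R w u.
Proof.
split=> [irr u [x [y [l [r [Rlr wE _]]]]]|irr l r Rlr].
  by case/negP: (irr l r Rlr); apply/infixP; exists x, y.
apply/negP => /infixP[x [y wE]]; apply: (irr (x ++ r ++ y)).
by exists x, y, l, r.
Qed.

(** * The sylvester rules as exchanges of adjacent letters *)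

Section Sylvester.
Variable n : nat.
Implicit Types (a b c : 'I_n) (s t u v w : word n).

(** One rewriting step, read from the left end of the word: the witness of a
    rule becomes a condition on the letters of the suffix, so that two steps
    from the same word can be compared letter by letter. *)
Inductive exchange : word n -> word n -> Prop :=
| ExchangeHead c a s :
    has (fun b => (a <= b)%O && (b < c)%O) s ->
    exchange [:: c, a & s] [:: a, c & s]
| ExchangeTail a s t : exchange s t -> exchange (a :: s) (a :: t).

Lemma one_stepP u v : one_step (sylvester_rule n) u v <-> exchange u v.
Proof.
split=> [[x [y [l [r [[a b c z ab bc] -> ->]]]]]|].
  elim: x => [|d x IH]; last exact: ExchangeTail.
  by rewrite /= -catA; apply: ExchangeHead; rewrite has_cat /= ab bc orbT.
elim=> {u v} [c a s /hasP[b /splitPr[z y] /andP[ab bc]]|a s t _ st].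
  exists [::], y, ([:: c; a] ++ z ++ [:: b]), ([:: a; c] ++ z ++ [:: b]).
  by split; rewrite /= -?catA //; exact: SylvesterRule.
by have := @one_step_context _ _ [:: a] [::] s t st; rewrite !cats0.
Qed.

Lemma exchange_rewrites u v :
  exchange u v -> rewrites (sylvester_rule n) u v.
Proof. by move=> uv; apply/rewrites_step/one_stepP. Qed.

Lemma exchange_perm u v : exchange u v -> perm_eq u v.
Proof.
elim=> {u v} [c a s _|a s t _ st]; last by rewrite perm_cons.
exact: permEl (perm_catCA [:: c] [:: a] s).
Qed.

(** The exchanged letters are strictly ordered because of the witness lying
    between them. *)
Lemma witness_lt a c s :
  has (fun b => (a <= b)%O && (b < c)%O) s -> (a < c)%O.
Proof. by case/hasP => b _ /andP[]; exact: le_lt_trans. Qed.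

Fixpoint inversions u : nat :=
  if u is a :: s then count (fun b => (b < a)%O) s + inversions s else 0.

(** Swapping $c > a$ removes the inversion that this pair forms and keeps all
    the others, since the letters on either side see the same multiset. *)
Lemma exchange_inversions u v : exchange u v -> inversions v < inversions u.
Proof.
elim=> {u v} [c a s /witness_lt ac|a s t st IH] /=.
  by rewrite ac (lt_gtF ac) add0n add1n !addSn ltnS addnCA.
by rewrite (permP (exchange_perm st)) ltn_add2l.
Qed.

Lemma sylvester_well_founded :
  well_founded (fun v u => one_step (sylvester_rule n) u v).
Proof.
apply: (well_founded_lt_compat _ inversions) => v u /one_stepP uv.
exact/ssrnat.ltP/exchange_inversions.
Qed.

(** The overlapping pair $dca \to cda$, $dca \to dac$: both sides reach
    $acd$. *)
Lemma overlap_joinable a c d s :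
  has (fun b => (c <= b)%O && (b < d)%O) (a :: s) ->
  has (fun b => (a <= b)%O && (b < c)%O) s ->
  joinable (sylvester_rule n) [:: c, d, a & s] [:: d, a, c & s].
Proof.
move=> wcd wac; have ac := witness_lt wac; have cd := witness_lt wcd.
have {}wcd : has (fun b => (c <= b)%O && (b < d)%O) s.
  by move: wcd; rewrite /= leNgt ac.
have wad : has (fun b => (a <= b)%O && (b < d)%O) s.
  apply: sub_has wac => b /andP[-> bc] /=; exact: lt_trans cd.
exists [:: a, c, d & s].
- apply: (@rewrites_trans _ _ [:: c, a, d & s]).
    exact/exchange_rewrites/ExchangeTail/ExchangeHead.
  by apply/exchange_rewrites/ExchangeHead; rewrite /= wac orbT.
- apply: (@rewrites_trans _ _ [:: a, d, c & s]).
    by apply/exchange_rewrites/ExchangeHead; rewrite /= wad orbT.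
  exact/exchange_rewrites/ExchangeTail/ExchangeHead.
Qed.

(** The two steps either overlap in [a], or the second one takes place inside
    [s], which it only permutes, so that the witness for $(c, a)$ remains. *)
Lemma head_tail_joinable a c s t :
  has (fun b => (a <= b)%O && (b < c)%O) s -> exchange (a :: s) t ->
  joinable (sylvester_rule n) [:: a, c & s] (c :: t).
Proof.
move=> wac; move tE: (a :: s) => as_ ast.
case: as_ t / ast tE => [a' e r we [aE sE]|a' s' t st [aE sE]].
  by rewrite -{}aE {}sE in we wac *; exact: overlap_joinable.
rewrite -{}aE -{}sE in st *; exists [:: a, c & t].
  exact/exchange_rewrites/ExchangeTail/ExchangeTail.
apply/exchange_rewrites/ExchangeHead.
by rewrite -(perm_has _ (exchange_perm st)).
Qed.

Lemma exchange_locally_confluent : locally_confluent (sylvester_rule n).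
Proof.
move=> u v w /one_stepP uv /one_stepP.
elim: uv w => {u v} [c a s wac|a s t st IH] w.
  move uE: [:: c, a & s] => u uw.
  case: u w / uw uE => [c' a' s' _ [-> -> ->]|c' s' t st [<- sE]].
    by exists [:: a', c' & s']; exact: rewrites_refl.
  by rewrite -{}sE in st; exact: head_tail_joinable.
move uE: (a :: s) => u uw.
case: u w / uw uE => [c' a' s' wac [aE sE]|a' s' t' st' [<- sE]].
  by rewrite {}aE {}sE in st *; exact/joinable_sym/head_tail_joinable.
by rewrite -{}sE in st'; apply: joinable_cons; exact: IH.
Qed.

Lemma sylvester_complete : complete_system (sylvester_rule n).
Proof.
split; first exact: well_founded_noetherian sylvester_well_founded.
exact: newman sylvester_well_founded exchange_locally_confluent.
Qed.

(** * Lexicographic order and irreducible words *)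

Lemma exchange_lexi u v :
  exchange u v -> ((v : seqlexi 'I_n) < (u : seqlexi 'I_n))%O.
Proof.
elim=> {u v} [c a s /witness_lt ac|a s t _ IH].
  by rewrite ltxi_cons (ltW ac) leNgt ac.
by rewrite ltxi_cons lexx.
Qed.

Lemma rewrites_lexi u v :
  rewrites (sylvester_rule n) u v ->
  ((v : seqlexi 'I_n) <= (u : seqlexi 'I_n))%O.
Proof.
elim=> {u v} [u v /one_stepP/exchange_lexi/ltW //|u|u v w _ vu _ wv].
  exact: lexx.
exact: le_trans wv vu.
Qed.

Lemma irreducible_lex_minimal w :
  irreducible_word (sylvester_rule n) w <-> lex_minimal_representative w.
Proof.
split=> [/irreducible_wordP irr u /elt_ofP uw|min_w].
  have [v uv wv] := church_rosser (proj2 sylvester_complete) uw.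
  case: (rewrites_inv wv) => [wE|[t /irr //]].
  by apply: rewrites_lexi; rewrite wE.
apply/irreducible_wordP => u wu.
have uw : sylvester_elt u = sylvester_elt w.
  exact/elt_ofP/CongrSym/rewrites_congruence/rewrites_step.
by have := min_w u uw; rewrite leNgt exchange_lexi //; apply/one_stepP.
Qed.

End Sylvester.

Theorem proposition5p3 (n : nat) (hn : (1 <= n)%N) :
  complete_system (sylvester_rule n) /\
  (forall w : word n,
     irreducible_word (sylvester_rule n) w <-> lex_minimal_representative w).
Proof.
split; first exact: sylvester_complete.
by move=> w; exact: irreducible_lex_minimal.
Qed.
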